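(* Let $k\ge2$. There is an isomorphism of monoids $\mathcal{P}^+_{k,\triangle}\to\mathrm{SSYT}(k-1,[k],\sim)$.
   Context: Write $[n]=\{1,\dots,n\}$. $\mathcal{P}^+_{k,\triangle}$ is the free commutative monoid (written multiplicatively) on the generators $Y_{i,i-2p}$ with $i\in[k-1]$, $p\in[i]$; it is a submonoid of the monoid of dominant monomials in the variables $Y_{i,s}$, $i\in[k-1]$, $s\in\mathbb{Z}$. $\mathrm{SSYT}(k-1,[k])$ is the set of semistandard Young tableaux (including the empty tableau) with at most $k-1$ rows and entries in $[k]$. For two such tableaux, $T\cup T'$ is the row-increasing tableau whose $i$-th row is the multiset union of the $i$-th rows of $T$ and $T'$ (rows beyond the last are empty). A trivial tableau is a one-column tableau with entries $1,\dots,p$ for some $p\in[k-1]$. For a tableau $T$, $T_{\mathrm{red}}$ is the semistandard tableau obtained from $T$ by removing (row by row, as multisets) a maximal trivial factor, i.e. a maximal $\cup$-product of trivial tableaux whose removal leaves a semistandard tableau. Put $S\sim T$ if $S_{\mathrm{red}}=T_{\mathrm{red}}$. $\mathrm{SSYT}(k-1,[k],\sim)$ is the set of $\sim$-equivalence classes, a commutative monoid under the product induced by $\cup$ with unit the class of the empty tableau. *)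

(* Defs.v *)
From HB Require Import structures.
From mathcomp Require Import all_boot ssralg ssrint.
From mathcomp Require Import multinomials.monalg.
From mathcomp Require Import boolp classical_sets.
From mathcomp Require Import zify.

Set Implicit Arguments.
Unset Strict Implicit.
Unset Printing Implicit Defensive.

(* [multinomials.monalg] and [classical_sets] shadow some names of [boot]. *)
Import monoid.
Local Open Scope nat_scope.

(* The index (i, s) of a variable Y_{i,s}; p ranges over 1, ..., i. *)
Definition triangle (k : nat) (x : nat * int) : bool :=
  (0 < x.1 < k) &&
  [exists p : 'I_x.1, x.2 == (x.1%:Z - 2%:Z * p.+1%:Z)%R].

Definition tri_gen (k : nat) := {x : nat * int | triangle k x}.

(* [{cmonom I}] is the free commutative monoid on [I]. *)
Definition Pplus (k : nat) : Type := {cmonom (tri_gen k)}.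

HB.instance Definition _ k := Choice.on (Pplus k).
HB.instance Definition _ k := isMonoid.Build (Pplus k)
  (@mulcmA (tri_gen k)) (@mul0cm (tri_gen k)) (@mulcm0 (tri_gen k)).

Lemma Pplus_mulC k : commutative (@mul (Pplus k)).
Proof. exact: mulcmC. Qed.

Definition row_ok (k : nat) (r : seq nat) : bool :=
  sorted leq r && all (fun a => 0 < a <= k) r.

(* [r'] may be placed directly below [r]. *)
Definition row_above (r r' : seq nat) : bool :=
  (size r' <= size r) && [forall j : 'I_(size r'), nth 0 r j < nth 0 r' j].

Definition semistandard (k : nat) (t : seq (seq nat)) : bool :=
  all (row_ok k) t && sorted row_above t.

(* Tableaux with at most k - 1 rows are padded with empty rows at the bottom,
   so that equality of tableaux is equality of the underlying tuples. *)
Record ssyt (k : nat) := Ssyt {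
  rows :> k.-1.-tuple (seq nat);
  rowsP : semistandard k rows
}.

HB.instance Definition _ k := [isSub for @rows k].
HB.instance Definition _ k := [Choice of ssyt k by <:].

(* Counting the entries smaller than [j]: a reformulation of the column
    condition that is additive in the rows. *)

Definition cntlt (r : seq nat) (j : nat) : nat := count (fun a => a < j) r.

Lemma cntlt_nth (r : seq nat) i j : sorted leq r ->
  (i < cntlt r j) = (i < size r) && (nth 0 r i < j).
Proof.
rewrite /cntlt; elim: r i => [|a r IHr] i //= pr.
have sr := path_sorted pr.
have /allP amin := order_path_min leq_trans pr.
have [aj|ja] := ltnP a j; first by case: i => [|i] //=; rewrite add1n !ltnS IHr.
have -> : count (fun b => b < j) r = 0.
  apply/eqP; rewrite -leqn0 leqNgt -has_count; apply/hasPn => b /amin ab.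
  by rewrite -leqNgt (leq_trans ja).
case: i => [|i] /=; first by rewrite [RHS]ltnNge ja.
rewrite ltnS; have [isz|] //= := ltnP i (size r).
by rewrite [RHS]ltnNge (leq_trans ja) // amin ?mem_nth.
Qed.

Lemma row_aboveP (r r' : seq nat) : sorted leq r -> sorted leq r' ->
  reflect (forall j, cntlt r' j.+1 <= cntlt r j) (row_above r r').
Proof.
move=> sr sr'; apply: (iffP andP) => [[le_sz /forallP lt_rr'] j|le_rr'].
  rewrite leqNgt; apply/negP; rewrite cntlt_nth // => /andP[lt_j le_j].
  have: cntlt r j < cntlt r j.
    rewrite {2}/cntlt cntlt_nth // (leq_trans lt_j le_sz) /=.
    exact: leq_trans (lt_rr' (Ordinal lt_j)) le_j.
  by rewrite ltnn.
have lt_rr' i : i < size r' -> (i < size r) && (nth 0 r i < nth 0 r' i).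
  move=> lt_i; rewrite -cntlt_nth //; apply: leq_trans (le_rr' _).
  by rewrite cntlt_nth // lt_i /=.
split; last by apply/forallP => j; case/andP: (lt_rr' _ (ltn_ord j)).
by rewrite leqNgt; apply/negP => /lt_rr'; rewrite ltnn.
Qed.

Lemma cntlt_cat r r' j : cntlt (r ++ r') j = cntlt r j + cntlt r' j.
Proof. exact: count_cat. Qed.

Lemma cntlt_perm r r' j : perm_eq r r' -> cntlt r j = cntlt r' j.
Proof. by move/permP; apply. Qed.

Lemma cntlt_nseq n a j : cntlt (nseq n a) j = (a < j) * n.
Proof. by rewrite /cntlt count_nseq. Qed.

Lemma leq_cntlt r j j' : j <= j' -> cntlt r j <= cntlt r j'.
Proof. by move=> le_j; apply: sub_count => a /= /leq_trans; apply. Qed.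

Lemma semistandardP k t : reflect
  [/\ forall i, row_ok k (nth [::] t i)
    & forall i j, cntlt (nth [::] t i.+1) j.+1 <= cntlt (nth [::] t i) j]
  (semistandard k t).
Proof.
apply: (iffP andP) => [[/(all_nthP [::]) t_ok /(sortedP [::]) t_col]|[t_ok t_col]].
  have ok i : row_ok k (nth [::] t i).
    by have [/t_ok|/(nth_default _) ->] := ltnP i (size t).
  split=> // i j; have [lt_i|] := ltnP i.+1 (size t); last first.
    by move/(nth_default _) ->.
  have /andP[s1 _] := ok i; have /andP[s2 _] := ok i.+1.
  by move: j; apply/row_aboveP => //; apply: t_col.
split; first by apply/(all_nthP [::]) => i _.
apply/(sortedP [::]) => i _; apply/row_aboveP => //.
- by case/andP: (t_ok i).
- by case/andP: (t_ok i.+1).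
Qed.

Section Product.
Variable k : nat.
Implicit Types S T : ssyt k.

Local Notation row T i := (nth [::] (rows T) i).

Lemma row_sorted T i : sorted leq (row T i).
Proof. by have /semistandardP[/(_ i)/andP[]] := rowsP T. Qed.

Lemma row_bounds T i : all (fun a => 0 < a <= k) (row T i).
Proof. by have /semistandardP[/(_ i)/andP[]] := rowsP T. Qed.

Lemma row_col T i j : cntlt (row T i.+1) j.+1 <= cntlt (row T i) j.
Proof. by have /semistandardP[] := rowsP T. Qed.

Lemma row_default T i : k.-1 <= i -> row T i = [::].
Proof. by move=> le_i; rewrite nth_default // size_tuple. Qed.

Lemma ssyt_eq S T :
  (forall i, i < k.-1 -> perm_eq (row S i) (row T i)) -> S = T.
Proof.
move=> eqST; apply/val_inj/val_inj/(@eq_from_nth _ [::]) => /=.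
  by rewrite !size_tuple.
move=> i; rewrite size_tuple => lt_i.
exact: (sorted_eq leq_trans anti_leq (row_sorted S i) (row_sorted T i) (eqST i _)).
Qed.

Definition mkrows (f : nat -> seq nat) : k.-1.-tuple (seq nat) :=
  [tuple f i | i < k.-1].

Lemma nth_mkrows f i : nth [::] (mkrows f) i = if i < k.-1 then f i else [::].
Proof.
have [lt_i|le_i] := ltnP; last by rewrite nth_default ?size_tuple.
by rewrite -[i]/(nat_of_ord (Ordinal lt_i)) -tnth_nth tnth_mktuple.
Qed.

Lemma mkrows_semistandard f :
  (forall i, i < k.-1 -> row_ok k (f i)) ->
  (forall i j, i.+1 < k.-1 -> cntlt (f i.+1) j.+1 <= cntlt (f i) j) ->
  semistandard k (mkrows f).
Proof.
move=> f_ok f_col; apply/semistandardP; split=> [i|i j]; rewrite !nth_mkrows.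
  by case: ifP => // /f_ok.
by case: ifP => // lt_i; rewrite (ltnW lt_i) f_col.
Qed.

Definition cup_rows S T : k.-1.-tuple (seq nat) :=
  mkrows (fun i => sort leq (row S i ++ row T i)).

Lemma cup_rowsP S T : semistandard k (cup_rows S T).
Proof.
apply: mkrows_semistandard => [i _|i j _].
  rewrite /row_ok sort_sorted; last exact: leq_total.
  by rewrite all_sort all_cat !row_bounds.
have c i' j' : cntlt (sort leq (row S i' ++ row T i')) j' =
    cntlt (row S i') j' + cntlt (row T i') j'.
  by rewrite -cntlt_cat; apply: cntlt_perm; rewrite perm_sort.
by rewrite !c leq_add // row_col.
Qed.

Definition cup S T : ssyt k := Ssyt (cup_rowsP S T).

Lemma empty_rowsP : semistandard k (mkrows (fun=> [::])).
Proof. exact: mkrows_semistandard. Qed.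

Definition empty_tab : ssyt k := Ssyt empty_rowsP.

Lemma row_cup S T i : perm_eq (row (cup S T) i) (row S i ++ row T i).
Proof.
rewrite nth_mkrows; have [lt_i|le_i] := ltnP; first by rewrite perm_sort.
by rewrite !row_default.
Qed.

Lemma row_empty i : row empty_tab i = [::].
Proof. by rewrite nth_mkrows if_same. Qed.

Lemma cupC : commutative cup.
Proof.
move=> S T; apply: ssyt_eq => i _.
by rewrite (permPl (row_cup _ _ _)) perm_sym (permPl (row_cup _ _ _)) perm_catC.
Qed.

Lemma cupA : associative cup.
Proof.
move=> S T U; apply: ssyt_eq => i _; rewrite (permPl (row_cup _ _ _)) perm_sym.
rewrite (permPl (row_cup _ _ _)) perm_sym.
have e1 : perm_eq (row S i ++ row (cup T U) i) (row S i ++ (row T i ++ row U i)).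
  by rewrite perm_cat2l row_cup.
have e2 : perm_eq (row (cup S T) i ++ row U i) ((row S i ++ row T i) ++ row U i).
  by rewrite perm_cat2r row_cup.
by rewrite (permPl e1) (permPr e2) catA.
Qed.

Lemma cup0T : left_id empty_tab cup.
Proof.
by move=> T; apply: ssyt_eq => i _; rewrite (permPl (row_cup _ _ _)) row_empty.
Qed.

Lemma cupT0 : right_id empty_tab cup.
Proof. by move=> T; rewrite cupC cup0T. Qed.

Lemma cupI S T U : cup S U = cup T U -> S = T.
Proof.
move=> eqST; apply: ssyt_eq => i _.
by rewrite -(perm_cat2r (row U i)) -(permPl (row_cup _ _ _)) eqST row_cup.
Qed.

End Product.

HB.instance Definition _ k := isMonoid.Build (ssyt k)
  (@cupA k) (@cup0T k) (@cupT0 k).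

Lemma ssyt_mulC k (S T : ssyt k) : (S * T = T * S)%g.
Proof. exact: cupC. Qed.

Lemma ssyt_mulIg k (U S T : ssyt k) : (S * U = T * U)%g -> S = T.
Proof. exact: cupI. Qed.

(* The column with entries 1, ..., p. *)
Definition column_rows (k p : nat) : k.-1.-tuple (seq nat) :=
  mkrows k (fun i => if i < p then [:: i.+1] else [::]).

Lemma column_rowsP k p : semistandard k (column_rows k p).
Proof.
apply: mkrows_semistandard => [i lt_i|i j lt_i].
  by case: ifP => // _; rewrite /row_ok /= andbT; lia.
have [|//] := ltnP i.+1 p => lt_ip; rewrite (ltnW lt_ip) /cntlt /= !addn0.
by rewrite ltnS.
Qed.

Definition trivial_tab (k p : nat) : ssyt k := Ssyt (column_rowsP k p).

Definition trivial_product (k : nat) (N : ssyt k) : Prop :=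
  exists2 s : seq nat, all (fun p => 0 < p < k) s
                     & N = (\prod_(p <- s) trivial_tab k p)%g.

Definition trivial_factor (k : nat) (T N : ssyt k) : Prop :=
  trivial_product N /\ exists S : ssyt k, T = (S * N)%g.

Definition maximal_trivial_factor (k : nat) (T N : ssyt k) : Prop :=
  trivial_factor T N /\
  forall N' : ssyt k, trivial_factor T N' ->
    (exists M : ssyt k, N' = (N * M)%g) -> N' = N.

Definition is_red (k : nat) (T S : ssyt k) : Prop :=
  exists2 N : ssyt k, maximal_trivial_factor T N & T = (S * N)%g.

(* [is_redP] and [is_red_unique] below show that the default value [T] is
   never used and that the choice is forced. *)
Definition red (k : nat) (T : ssyt k) : ssyt k := xget T [set S | is_red T S].

Section Reduction.
Variable k : nat.
Implicit Types S T N M : ssyt k.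

Local Notation row T i := (nth [::] (rows T) i).
Local Notation triv s := (\prod_(p <- s) trivial_tab k p)%g.

Lemma row_mul S T i : perm_eq (row (S * T)%g i) (row S i ++ row T i).
Proof. exact: row_cup. Qed.

Lemma cntlt_mul S T i j :
  cntlt (row (S * T)%g i) j = cntlt (row S i) j + cntlt (row T i) j.
Proof. by rewrite -cntlt_cat; apply/cntlt_perm/row_mul. Qed.

Lemma triv_cat s s' : triv (s ++ s') = (triv s * triv s')%g.
Proof. exact: big_cat. Qed.

Lemma row_triv s i : i < k.-1 ->
  perm_eq (row (triv s) i) (nseq (count (fun p => i < p) s) i.+1).
Proof.
move=> lt_i; elim: s => [|p s IHs]; first by rewrite big_nil row_empty.
rewrite big_cons (permPl (row_mul _ _ _)) [count _ (p :: s)]/= nseqD perm_cat //.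
by rewrite nth_mkrows lt_i; case: ifP.
Qed.

Lemma triv_perm s s' : perm_eq s s' -> triv s = triv s'.
Proof.
move=> /permP eq_s; apply: ssyt_eq => i lt_i.
by rewrite (permPl (row_triv s lt_i)) eq_s perm_sym row_triv.
Qed.

Lemma cntlt_triv s i j : i < k.-1 ->
  cntlt (row (triv s) i) j = (i.+1 < j) * count (fun p => i < p) s.
Proof. by move=> /(row_triv s)/cntlt_perm->; rewrite cntlt_nseq. Qed.

Lemma count_ltS (s : seq nat) i :
  count (fun p => i < p) s = count (fun p => i.+1 < p) s + count_mem i.+1 s.
Proof.
elim: s => //= p s ->; rewrite addnACA; congr (_ + _).
by rewrite (leq_eqVlt i.+1 p) [p == _]eq_sym; case: eqP => [<-|_]; rewrite ?ltnn ?addn0.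
Qed.

Lemma count_out (s : seq nat) i : all (fun p => 0 < p < k) s -> k.-1 <= i ->
  count (fun p => i < p) s = 0.
Proof.
move=> /allP s_ok le_i; apply/eqP; rewrite -leqn0 leqNgt -has_count.
by apply/hasPn => p /s_ok; lia.
Qed.

(* The multiplicity of the column 1, ..., i + 1 in the maximal trivial factor. *)
Definition slack T i : nat :=
  \big[minn/size (row T i) - size (row T i.+1)]_(i.+2 <= j < k.+2)
    (cntlt (row T i) j - cntlt (row T i.+1) j.+1).

Lemma bigmin_addr (F : nat -> nat) x0 c m n :
  \big[minn/x0 + c]_(m <= j < n) (F j + c) = \big[minn/x0]_(m <= j < n) F j + c.
Proof. by apply/esym/(big_morph (addn^~ c)) => // x y; exact: addn_minl. Qed.

Lemma slack_mul S s i : i < k.-1 -> all (fun p => 0 < p < k) s ->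
  slack (S * triv s)%g i = slack S i + count_mem i.+1 s.
Proof.
move=> lt_i s_ok; set c := count_mem _ _.
have szE T i' : size (row T i') = cntlt (row T i') k.+1.
  apply/esym/eqP; rewrite /cntlt -all_count.
  by apply: sub_all (row_bounds T i') => a; rewrite ltnS => /andP[].
have szE' T i' : size (row T i') = cntlt (row T i') k.+2.
  by apply/eqP; rewrite eqn_leq count_size andbT szE leq_cntlt.
have diff j : i.+2 <= j ->
    cntlt (row (S * triv s)%g i) j - cntlt (row (S * triv s)%g i.+1) j.+1 =
    cntlt (row S i) j - cntlt (row S i.+1) j.+1 + c.
  move=> le_j; rewrite !cntlt_mul cntlt_triv // le_j mul1n count_ltS -/c.
  have le_row := row_col S i j.
  have [lt_i1|le_i1] := ltnP i.+1 k.-1.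
    by rewrite cntlt_triv // ltnS le_j mul1n; lia.
  by rewrite (count_out s_ok le_i1) !(row_default _ le_i1) /=; lia.
rewrite /slack [LHS]big_nat (eq_bigr (fun j =>
  cntlt (row S i) j - cntlt (row S i.+1) j.+1 + c)); last first.
  by move=> j /andP[le_j _]; apply: diff.
rewrite -big_nat szE szE' diff; last by lia.
by rewrite bigmin_addr -szE -szE'.
Qed.

Lemma leq_bigmin (F : nat -> nat) x0 m n j : m <= j < n ->
  \big[minn/x0]_(m <= l < n) F l <= F j.
Proof.
move=> mj; have: j \in index_iota m n by rewrite mem_index_iota.
elim: (index_iota m n) => // l s IHs; rewrite inE big_cons => /predU1P[->|/IHs].
  exact: geq_minl.
by apply: leq_trans; apply: geq_minr.
Qed.

Lemma slack_le T i j : i.+2 <= j ->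
  slack T i + cntlt (row T i.+1) j.+1 <= cntlt (row T i) j.
Proof.
move=> le_j; have le_row := row_col T i j.
have [lt_j|ge_j] := ltnP j k.+2.
  have: slack T i <= cntlt (row T i) j - cntlt (row T i.+1) j.+1.
    by apply: leq_bigmin; rewrite le_j.
  by lia.
have szE i' j' : k < j' -> size (row T i') = cntlt (row T i') j'.
  move=> lt_j'; apply/esym/eqP; rewrite /cntlt -all_count.
  by apply: sub_all (row_bounds T i') => a /andP[_ /leq_ltn_trans]; apply.
have: slack T i <= size (row T i) - size (row T i.+1).
  rewrite /slack; elim: (index_iota _ _) => [|l s IHs]; first by rewrite big_nil.
  by rewrite big_cons; apply: leq_trans IHs; apply: geq_minr.
rewrite (szE i j) ?(szE i.+1 j.+1); lia.
Qed.

Lemma row_ge T i : cntlt (row T i) i.+1 = 0.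
Proof.
elim: i => [|i IHi]; apply/eqP; rewrite -leqn0.
  rewrite leqNgt -has_count; apply/hasPn => a /(allP (row_bounds T 0)).
  by rewrite ltnS -ltnNge => /andP[].
by rewrite -IHi row_col.
Qed.

Definition slack_seq T : seq nat :=
  flatten [seq nseq (slack T i) i.+1 | i <- iota 0 k.-1].

Lemma slack_seq_ok T : all (fun p => 0 < p < k) (slack_seq T).
Proof.
apply/allP => p /flatten_mapP[i]; rewrite mem_iota => lt_i.
by rewrite mem_nseq => /andP[_ /eqP->]; lia.
Qed.

Lemma count_slack_seq T i : i < k.-1 -> count_mem i.+1 (slack_seq T) = slack T i.
Proof.
move=> lt_i; rewrite /slack_seq count_flatten -map_comp sumnE big_map.
have i_in : i \in iota 0 k.-1 by rewrite mem_iota.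
rewrite (bigD1_seq i) ?iota_uniq //= count_nseq /= eqxx mul1n.
rewrite big1 ?addn0 // => i' ne_i.
by rewrite count_nseq /= eqSS (negPf ne_i).
Qed.

(* Dropping the leading entries [i + 1] of row [i] realises the quotient of a
   tableau by a product of trivial tableaux. *)
Lemma trivial_division T s : all (fun p => 0 < p < k) s ->
  (forall i, i < k.-1 -> count_mem i.+1 s <= slack T i) ->
  exists S, T = (S * triv s)%g.
Proof.
move=> s_ok le_s; pose d i := count (fun p => i < p) s.
have dE i : d i = d i.+1 + count_mem i.+1 s by exact: count_ltS.
have d0 i : k.-1 <= i -> d i = 0 by exact: count_out.
have le_col i j : i.+2 <= j ->
    count_mem i.+1 s + cntlt (row T i.+1) j.+1 <= cntlt (row T i) j.
  move=> le_j; have [lt_i|le_i] := ltnP i k.-1.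
    by apply: leq_trans (slack_le T le_j); rewrite leq_add2r le_s.
  by rewrite (row_default T (leqW le_i)) /=; have := dE i;
    rewrite (d0 _ le_i) (d0 _ (leqW le_i)) add0n => <-.
have le_d i : d i <= cntlt (row T i) i.+2.
  have [n] := ubnP (k.-1 - i); elim: n i => // n IHn i lt_n.
  have [lt_i|/d0-> //] := ltnP i k.-1.
  have /IHn IHi : k.-1 - i.+1 < n by lia.
  by rewrite dE addnC; apply: leq_trans (le_col _ _ (leqnn _)); rewrite leq_add2l.
have takeE i : take (d i) (row T i) = nseq (d i) i.+1.
  have sz : size (take (d i) (row T i)) = d i.
    by rewrite size_takel // (leq_trans (le_d i)) ?count_size.
  rewrite -[X in nseq X _]sz; apply/all_pred1P/(all_nthP 0) => l; rewrite sz => lt_l /=.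
  rewrite nth_take // eqn_leq.
  have := cntlt_nth l i.+2 (row_sorted T i).
  rewrite (leq_trans lt_l (le_d i)) => /esym/andP[lt_sz]; rewrite ltnS => -> /=.
  have := cntlt_nth l i.+1 (row_sorted T i).
  by rewrite row_ge lt_sz ltn0 /= => /esym/negbT; rewrite -leqNgt.
have dropE i j :
    cntlt (row T i) j = (i.+1 < j) * d i + cntlt (drop (d i) (row T i)) j.
  by rewrite -{1}(cat_take_drop (d i) (row T i)) cntlt_cat takeE cntlt_nseq.
have ss : semistandard k (mkrows k (fun i => drop (d i) (row T i))).
  apply: mkrows_semistandard => [i _|i j lt_i].
    rewrite /row_ok drop_sorted ?row_sorted //=.
    by apply/allP => a /mem_drop /(allP (row_bounds T i)).
  have [le_j|lt_j] := leqP i.+2 j.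
    have := le_col i j le_j; have := dropE i j; have := dropE i.+1 j.+1.
    by rewrite ltnS le_j (dE i) !mul1n; lia.
  have := leq_cntlt (row T i.+1) (lt_j : j.+1 <= i.+2).
  by rewrite row_ge; have := dropE i.+1 j.+1; lia.
exists (Ssyt ss); apply: ssyt_eq => i lt_i.
rewrite perm_sym (permPl (row_mul _ _ _)) nth_mkrows lt_i.
rewrite -{2}(cat_take_drop (d i) (row T i)) perm_catC perm_cat2r takeE.
exact: row_triv.
Qed.

Lemma trivial_factor_dvd T s : all (fun p => 0 < p < k) s ->
  (exists S, T = (S * triv s)%g) ->
  exists s', triv (slack_seq T) = (triv s * triv s')%g.
Proof.
move=> s_ok [S TE].
have /count_subseqP[s1 s1_sub s_s1] x : count_mem x s <= count_mem x (slack_seq T).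
  have [x_ok|x_out] := boolP (0 < x < k); last first.
    rewrite leqNgt; apply/negP => /(leq_ltn_trans (leq0n _)).
    by rewrite -has_count has_pred1 => /(allP s_ok); apply/negP.
  case: x x_ok => // i lt_i; have {}lt_i : i < k.-1 by lia.
  by rewrite count_slack_seq // TE slack_mul // leq_addl.
have [s' eq_s'] := perm_to_subseq s1_sub; exists s'.
by rewrite -triv_cat; apply: triv_perm; rewrite (permPl eq_s') perm_cat2r perm_sym.
Qed.

Lemma mul_eq_empty S T : (S * T = 1)%g -> S = 1%g.
Proof.
move=> ST1; apply: ssyt_eq => i _; rewrite row_empty.
have := row_mul S T i; rewrite ST1 row_empty => /perm_size/esym/eqP.
by rewrite size_cat addn_eq0 => /andP[/nilP-> _].
Qed.

Lemma slack_seq_factor T : exists S, T = (S * triv (slack_seq T))%g.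
Proof.
apply: trivial_division => [|i lt_i]; first exact: slack_seq_ok.
by rewrite count_slack_seq.
Qed.

Lemma maximal_trivial_factorP T N :
  maximal_trivial_factor T N <-> N = triv (slack_seq T).
Proof.
split=> [[[[s s_ok ->] Tdvd] N_max]|->].
  have [s' eq_s'] := trivial_factor_dvd s_ok Tdvd.
  apply/esym/N_max; last by exists (triv s').
  by split; [exists (slack_seq T); first exact: slack_seq_ok | exact: slack_seq_factor].
split; first by split; [exists (slack_seq T); first exact: slack_seq_ok | exact: slack_seq_factor].
move=> N' [[s s_ok ->]] Tdvd [M N'E].
have [s' eq_s'] := trivial_factor_dvd s_ok Tdvd.
suff M1 : M = 1%g by rewrite N'E M1 mulg1.
apply: (@mul_eq_empty _ (triv s')); apply: (@ssyt_mulIg _ (triv (slack_seq T))).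
by rewrite mul1g [RHS]eq_s' N'E ssyt_mulC -mulgA.
Qed.

Lemma is_red_unique T S S' : is_red T S -> is_red T S' -> S = S'.
Proof.
move=> [N /maximal_trivial_factorP-> TE] [N' /maximal_trivial_factorP-> TE'].
by apply: (@ssyt_mulIg _ (triv (slack_seq T))); rewrite -TE.
Qed.

Lemma is_redP T : is_red T (red T).
Proof.
have [S TE] := slack_seq_factor T; apply: (@xgetI _ T [set S | is_red T S] S).
by exists (triv (slack_seq T)); first exact/maximal_trivial_factorP.
Qed.

Lemma red_mul_triv T N : trivial_product N -> red (T * N)%g = red T.
Proof.
move=> [s s_ok ->]; have [N1 /maximal_trivial_factorP-> TE] := is_redP T.
have [N2 /maximal_trivial_factorP-> TE'] := is_redP (T * triv s)%g.
have eq_s : perm_eq (slack_seq (T * triv s)%g) (slack_seq T ++ s).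
  apply/allP => x; rewrite !mem_cat => x_in.
  have x_ok : 0 < x < k.
    have slack_ok U : x \in slack_seq U -> 0 < x < k by exact: (allP (slack_seq_ok U)).
    by case/or3P: x_in => [/slack_ok|/slack_ok|/(allP s_ok)].
  case: x x_ok {x_in} => // i lt_i; have {}lt_i : i < k.-1 by lia.
  by rewrite /= count_cat !count_slack_seq // slack_mul.
apply: (@ssyt_mulIg _ (triv (slack_seq (T * triv s)%g))).
by rewrite -TE' (triv_perm eq_s) triv_cat mulgA -TE.
Qed.

End Reduction.

Definition tab_sim (k : nat) (S T : ssyt k) : bool := red S == red T.

Lemma tab_sim_refl k : reflexive (@tab_sim k).
Proof. by move=> S; apply: eqxx. Qed.

Lemma tab_sim_sym k : symmetric (@tab_sim k).
Proof. by move=> S T; apply: eq_sym. Qed.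

Lemma tab_sim_trans k : transitive (@tab_sim k).
Proof. by move=> S T U /eqP TS; rewrite /tab_sim TS. Qed.

Canonical tab_sim_equiv k :=
  EquivRel (@tab_sim k) (@tab_sim_refl k) (@tab_sim_sym k) (@tab_sim_trans k).

Definition ssyt_sim (k : nat) : Type := {eq_quot (tab_sim_equiv k)}%qT.

HB.instance Definition _ k := Choice.on (ssyt_sim k).
HB.instance Definition _ k := EqQuotient.on (ssyt_sim k).

Lemma red_mulr k (S T : ssyt k) : red (S * T)%g = red (red S * T)%g.
Proof.
have [N [[N_triv _] _] SE] := is_redP S.
rewrite {1}SE -mulgA [(N * T)%g]ssyt_mulC mulgA.
exact: red_mul_triv.
Qed.

Section QuotientMonoid.
Variable k : nat.
Local Open Scope quotient_scope.

Definition sim_mul : ssyt_sim k -> ssyt_sim k -> ssyt_sim k :=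
  lift_op2 (ssyt_sim k) (@mul (ssyt k)).

Definition sim_one : ssyt_sim k := \pi 1%g.

Lemma pi_sim_mul : {morph \pi_(ssyt_sim k) : S T / (S * T)%g >-> sim_mul S T}.
Proof.
move=> S T; unlock sim_mul; apply/eqmodP; rewrite /= /tab_sim.
have simE U : red (repr (\pi_(ssyt_sim k) U)) = red U.
  by apply/eqP; have /eqmodP := reprK (\pi_(ssyt_sim k) U).
rewrite red_mulr -(simE S) -red_mulr [(_ * T)%g]ssyt_mulC.
by rewrite red_mulr -(simE T) -red_mulr [(_ * repr _)%g]ssyt_mulC.
Qed.

Lemma sim_mulA : associative sim_mul.
Proof.
elim/quotW=> S; elim/quotW=> T; elim/quotW=> U.
by rewrite -!pi_sim_mul mulgA.
Qed.

Lemma sim_mulC : commutative sim_mul.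
Proof.
elim/quotW=> S; elim/quotW=> T.
by rewrite -!pi_sim_mul; rewrite ssyt_mulC.
Qed.

Lemma sim_mul1 : left_id sim_one sim_mul.
Proof. by elim/quotW=> S; rewrite -pi_sim_mul mul1g. Qed.

Lemma sim_mulr1 : right_id sim_one sim_mul.
Proof. by elim/quotW=> S; rewrite -pi_sim_mul mulg1. Qed.

End QuotientMonoid.

HB.instance Definition _ k := isMonoid.Build (ssyt_sim k)
  (@sim_mulA k) (@sim_mul1 k) (@sim_mulr1 k).

Lemma ssyt_sim_mulC k (x y : ssyt_sim k) : (x * y = y * x)%g.
Proof. exact: sim_mulC. Qed.

Lemma pi_ssyt_mul k (S T : ssyt k) :
  (\pi_(ssyt_sim k) (S * T)%g = \pi_(ssyt_sim k) S * \pi_(ssyt_sim k) T)%g%qT.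
Proof. exact: pi_sim_mul. Qed.

Lemma pi_ssyt_one k : (\pi_(ssyt_sim k) 1%g = 1%g)%qT.
Proof. by []. Qed.

Lemma pi_ssyt_eq k (S T : ssyt k) :
  reflect (red S = red T) (\pi_(ssyt_sim k) S == \pi_(ssyt_sim k) T)%qT.
Proof. by rewrite eqmodE; apply: eqP. Qed.

(* Main.v *)
Require Import Defs.
From mathcomp Require Import all_boot.
From mathcomp Require Import ssralg ssrint finmap.
From mathcomp Require Import multinomials.monalg.
From mathcomp Require Import zify.

(** Number the rows from 0.  In a semistandard tableau the entries of row [i]
are at least [i + 1], and a trivial tableau contributes to row [i] nothing but
entries [i + 1].  So multiplying by trivial tableaux only changes how often
[i + 1] occurs in row [i], for all [i]; call these the leading entries, and the
others the free entries.

Two tableaux are equivalent exactly when they have the same free entries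
([red_eqP]).  If they have, the numbers of their leading entries can be made
equal by multiplying each tableau by a product of trivial ones: the required
numbers of leading entries only have to decrease weakly with the row, and a
common, steeply decreasing amount can be added on both sides.

Conversely the free entries can be prescribed arbitrarily.  Putting enough
leading entries in a row makes the column condition hold against the row
below, whatever the free entries are; [reserve] is a sufficient number which
is moreover additive, so that the chosen tableau [tab_of] depends
multiplicatively on the prescribed multiplicities.

Hence the quotient is the free commutative monoid on the pairs [(i, a)] with
[i + 2 <= a <= k].  These pairs correspond to the variables: row [i] and entry
[a] to the variable with first index [a - 1] and [p = i + 1].  In other words
the variable [Y_(n, n - 2p)] is sent to the class of the column
[1, ..., p - 1, n + 1]. *)
Set Implicit Arguments.
Unset Strict Implicit.
Unset Printing Implicit Defensive.

Import monoid.
Local Open Scope nat_scope.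

(** The index of the variable that stands for a free entry [a] in row [i]. *)
Definition tri_index (i a : nat) : nat * int :=
  (a.-1, a.-1%:Z - 2%:Z * i.+1%:Z)%R.

Lemma triangle_index k i a : triangle k (tri_index i a) = (i.+2 <= a <= k).
Proof.
apply/andP/idP => /= [[a_bd /existsP[p /eqP]]|ia]; first by have := ltn_ord p; lia.
have lt_i : i < a.-1 by lia.
by split; [lia | apply/existsP; exists (Ordinal lt_i)].
Qed.

Lemma tri_gen_index k (x : tri_gen k) : exists i a, val x = tri_index i a.
Proof.
case: x => [[n s]] /= x_tri; have /andP[/= n_bd /existsP[p /eqP sE]] := x_tri.
by exists p, n.+1; rewrite /tri_index sE.
Qed.

(** Defined for all [i] and [a], with value 0 outside the triangle: sums and
row fillings can then range over plain intervals of natural numbers. *)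
Definition expo k (g : Pplus k) (i a : nat) : nat :=
  oapp (g : tri_gen k -> nat) 0 (insub (tri_index i a)).

Lemma expo_out k (g : Pplus k) i a : ~~ (i.+2 <= a <= k) -> expo g i a = 0.
Proof. by rewrite -triangle_index /expo; case: insubP => // x ->. Qed.

Lemma expo1 k i a : expo (1%g : Pplus k) i a = 0.
Proof. by rewrite /expo; case: insub => //= x; apply: onecmE. Qed.

Lemma expoM k (g h : Pplus k) i a : expo (g * h)%g i a = expo g i a + expo h i a.
Proof. by rewrite /expo; case: insub => //= x; apply: mulcmE. Qed.

Lemma expo_inj k (g h : Pplus k) :
  (forall i a, expo g i a = expo h i a) -> g = h.
Proof.
move=> eq_gh; apply/eqP/cmP => x; have [i [a xE]] := tri_gen_index x.
by have := eq_gh i a; rewrite /expo -xE valK.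
Qed.

Lemma expo_surj k (F : nat -> nat -> nat) :
  exists g : Pplus k, forall i a, i.+2 <= a <= k -> expo g i a = F i a.
Proof.
pose idx := [seq tri_index i a | i <- iota 0 k, a <- iota 0 k.+1].
pose s : seq (tri_gen k) := pmap insub idx.
pose G (x : tri_gen k) := F (`|(val x).1%:Z - (val x).2|%N./2.-1)%R (val x).1.+1.
(* [G] reads the row and the entry back from the index; [s] lists all the
   variables, which provides the finite support. *)
exists ([cmonom G x | x in [fset x | x in s]%fset]%M : Pplus k) => i a ia.
have ia_tri : triangle k (tri_index i a) by rewrite triangle_index.
rewrite /expo insubT /= cmE fsfun_fun inE /=.
rewrite mem_pmap_sub /= ifT; last first.
  by apply/allpairsP; exists (i, a); rewrite !mem_iota; split=> //=; lia.
by rewrite /G /tri_index /=; congr F; lia.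
Qed.

Definition spread (F : nat -> nat) (k : nat) : seq nat :=
  sort leq (flatten [seq nseq (F a) a | a <- iota 1 k]).

Lemma count_spread F k a : 0 < a <= k -> count_mem a (spread F k) = F a.
Proof.
move=> a_bd; rewrite /spread (permP (permEl (perm_sort _ _))).
rewrite count_flatten -map_comp sumnE big_map.
have a_in : a \in iota 1 k by rewrite mem_iota; lia.
rewrite (bigD1_seq a) ?iota_uniq //= count_nseq /= eqxx mul1n.
by rewrite big1 ?addn0 // => b ne_b; rewrite count_nseq /= (negPf ne_b).
Qed.

Lemma spread_bounds F k : all (fun a => 0 < a <= k) (spread F k).
Proof.
rewrite all_sort; apply/allP => p /flatten_mapP[a]; rewrite mem_iota => a_bd.
by rewrite mem_nseq => /andP[_ /eqP->]; lia.
Qed.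

Lemma row_ok_spread F k : row_ok k (spread F k).
Proof. by rewrite /row_ok spread_bounds sort_sorted //; apply: leq_total. Qed.

Lemma cntlt_spread F k j :
  cntlt (spread F k) j = \sum_(1 <= a < k.+1) (a < j) * F a.
Proof.
rewrite /cntlt /spread (permP (permEl (perm_sort _ _))).
rewrite count_flatten -map_comp sumnE big_map /index_iota subSS subn0.
by apply: eq_bigr => a _; rewrite /= count_nseq.
Qed.

(** The number of leading entries given to row [i]: the number of free entries
in all the rows below.  A smaller number could satisfy the column condition,
but this one is additive in [g]; it is the number of leading entries of row [i]
in the product of the columns that are the images of the variables. *)
Definition reserve k (g : Pplus k) (i : nat) : nat :=
  \sum_(i.+1 <= l < k) \sum_(1 <= a < k.+1) expo g l a.

Definition filling k (g : Pplus k) (i a : nat) : nat :=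
  (a == i.+1) * reserve g i + expo g i a.

Lemma reserveM k (g h : Pplus k) i :
  reserve (g * h)%g i = reserve g i + reserve h i.
Proof.
rewrite /reserve -big_split /=; apply: eq_bigr => l _.
by rewrite -big_split /=; apply: eq_bigr => a _; rewrite expoM.
Qed.

Lemma fillingM k (g h : Pplus k) i a :
  filling (g * h)%g i a = filling g i a + filling h i a.
Proof. by rewrite /filling reserveM expoM mulnDr addnACA. Qed.

(** Row [i + 1] has [reserve g (i + 1)] leading entries and its free entries,
[reserve g i] entries in total.  So it fits below the leading entries of row
[i] alone, which are smaller than all of its entries. *)
Lemma filling_rowsP k (g : Pplus k) :
  semistandard k (mkrows k (fun i => spread (filling g i) k)).
Proof.
apply: mkrows_semistandard => [i _|i j lt_i]; first exact: row_ok_spread.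
rewrite !cntlt_spread; have [le_j|lt_j] := leqP i.+2 j; last first.
  (* Row [i + 1] has no entry below [i + 2]. *)
  rewrite big_nat big1 // => a /andP[_ _]; rewrite /filling.
  have [lt_aj|//] := ltnP a j.+1; rewrite expo_out ?addn0; last by lia.
  by rewrite (_ : (a == i.+2) = false) //; lia.
apply: (@leq_trans (reserve g i)).
  rewrite /reserve (big_ltn (_ : i.+1 < k)); last by lia.
  rewrite addnC.
  apply: (@leq_trans (\sum_(1 <= a < k.+1) filling g i.+1 a)).
    by apply: leq_sum => a _; case: (a < _); rewrite ?mul1n.
  rewrite big_split /= leq_add2r.
  rewrite (bigD1_seq i.+2) ?iota_uniq ?mem_index_iota //=; last by lia.
  by rewrite eqxx mul1n big1 ?addn0 // => a /negPf->.
rewrite (bigD1_seq i.+1) ?iota_uniq ?mem_index_iota //=; last by lia.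
by rewrite /filling le_j eqxx !mul1n -addnA leq_addr.
Qed.

Definition tab_of k (g : Pplus k) : ssyt k := Ssyt (filling_rowsP g).

Lemma count_tab_of k (g : Pplus k) i a : i < k.-1 ->
  count_mem a (nth [::] (rows (tab_of g)) i) = filling g i a.
Proof.
move=> lt_i; rewrite nth_mkrows lt_i.
have [a_bd|a_out] := boolP (0 < a <= k); first exact: count_spread.
have a_lead : a != i.+1 by lia.
have a_free : ~~ (i.+2 <= a <= k) by lia.
rewrite /filling (negPf a_lead) expo_out //.
apply/count_memPn; apply/negP => /(allP (spread_bounds _ _)).
exact/negP.
Qed.

Lemma ssyt_eq_count k (S T : ssyt k) :
  (forall i a, i < k.-1 -> count_mem a (nth [::] (rows S) i)
                         = count_mem a (nth [::] (rows T) i)) -> S = T.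
Proof.
by move=> eqST; apply: ssyt_eq => i lt_i; apply/allP => a _; apply/eqP/eqST.
Qed.

Lemma count_mul k (S T : ssyt k) i a :
  count_mem a (nth [::] (rows (S * T)%g) i)
  = count_mem a (nth [::] (rows S) i) + count_mem a (nth [::] (rows T) i).
Proof. by rewrite (permP (row_mul S T i)) count_cat. Qed.

Lemma tab_of1 k : tab_of (1%g : Pplus k) = 1%g.
Proof.
apply: ssyt_eq_count => i a lt_i; rewrite count_tab_of // row_empty /=.
rewrite /filling expo1 addn0 /reserve big1 ?muln0 // => l _.
by rewrite big1 // => b _; rewrite expo1.
Qed.

Lemma tab_ofM k (g h : Pplus k) : tab_of (g * h)%g = (tab_of g * tab_of h)%g.
Proof.
apply: ssyt_eq_count => i a lt_i.
by rewrite count_mul !count_tab_of // fillingM.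
Qed.

Lemma count_triv k s i a : i < k.-1 ->
  count_mem a (nth [::] (rows (\prod_(p <- s) trivial_tab k p)%g) i)
  = (a == i.+1) * count (fun p => i < p) s.
Proof.
by move=> lt_i; rewrite (permP (row_triv s lt_i)) count_nseq /= eq_sym.
Qed.

(** The column of height [p] is used [d (p - 1) - d p] times; the number of
columns of height more than [i] then telescopes to [d i]. *)
Lemma exists_trivial_exponents k (d : nat -> nat) :
  (forall i, i < k.-1 -> d i.+1 <= d i) -> d k.-1 = 0 ->
  exists2 s, all (fun p => 0 < p < k) s
           & forall i, i < k.-1 -> count (fun p => i < p) s = d i.
Proof.
move=> d_dec d0; pose F p := d p.-1 - d p.
have s_ok : all (fun p => 0 < p < k) (spread F k.-1).
  by apply: sub_all (spread_bounds _ _) => p; lia.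
exists (spread F k.-1) => // i.
(* Induction on [k - 1 - i], from the lowest row upwards. *)
have [n] := ubnP (k.-1 - i); elim: n i => // n IHn i lt_n lt_i.
rewrite count_ltS count_spread /F /=; last by lia.
have [lt_i1|ge_i1] := ltnP i.+1 k.-1.
  by rewrite IHn ?subnKC ?d_dec //; lia.
have i1E : i.+1 = k.-1 by lia.
by rewrite (count_out s_ok) // i1E d0 subn0.
Qed.

(** The equivalence forgets the leading entries and nothing else.  From left to
right, passing to the reduction removes leading entries only.  From right to
left, write [m S] and [m T] for the numbers of leading entries: multiplying [S]
by trivial tableaux with [m T + R] leading entries and [T] by trivial tableaux
with [m S + R] makes them equal. *)
Lemma red_eqP k (S T : ssyt k) :
  red S = red T <->
  forall i a, i < k.-1 -> a != i.+1 ->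
    count_mem a (nth [::] (rows S) i) = count_mem a (nth [::] (rows T) i).
Proof.
split=> [eq_red i a lt_i /negPf ne_a|eq_off].
  have redE (U : ssyt k) : count_mem a (nth [::] (rows U) i)
              = count_mem a (nth [::] (rows (red U)) i).
    have [N [[[s _ ->] _] _] UE] := is_redP U.
    by rewrite {1}UE count_mul count_triv // ne_a addn0.
  by rewrite (redE S) (redE T) eq_red.
pose m (U : ssyt k) i := count_mem i.+1 (nth [::] (rows U) i).
(* [R i] sums all the leading entries of both tableaux below row [i], so that
   [m S + R] and [m T + R] decrease weakly although [m S] and [m T] may not. *)
pose R i := \sum_(i.+1 <= l < k.-1) (m S l + m T l).
have Rlt i : i.+1 < k.-1 -> R i = m S i.+1 + m T i.+1 + R i.+1.
  by move=> lt_i; rewrite /R big_ltn.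
have m0 (U : ssyt k) : m U k.-1 = 0 by rewrite /m row_default.
have R0 i : k.-1 <= i.+1 -> R i = 0 by move=> le_i; rewrite /R big_geq.
have dec (U : ssyt k) : U = S \/ U = T -> forall i, i < k.-1 ->
    m U i.+1 + R i.+1 <= m U i + R i.
  move=> US i lt_i; have [lt_i1|ge_i1] := ltnP i.+1 k.-1.
    by rewrite (Rlt i) //; case: US => ->; lia.
  have i1E : i.+1 = k.-1 by lia.
  by rewrite i1E m0 R0.
have [s s_ok sE] : exists2 s, all (fun p => 0 < p < k) s &
    forall i, i < k.-1 -> count (fun p => i < p) s = m T i + R i.
  by apply: exists_trivial_exponents; [apply: dec; right | rewrite m0 R0].
have [s' s'_ok s'E] : exists2 s, all (fun p => 0 < p < k) s &
    forall i, i < k.-1 -> count (fun p => i < p) s = m S i + R i.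
  by apply: exists_trivial_exponents; [apply: dec; left | rewrite m0 R0].
have trivP q : all (fun p => 0 < p < k) q ->
    trivial_product (\prod_(p <- q) trivial_tab k p)%g by exists q.
rewrite -(red_mul_triv S (trivP s s_ok)) -(red_mul_triv T (trivP s' s'_ok)).
congr red; apply: ssyt_eq_count => i a lt_i.
rewrite !count_mul !count_triv // sE // s'E //.
have [->|ne_a] := eqVneq a i.+1; last by rewrite !addn0 eq_off.
by rewrite !mul1n addnCA.
Qed.

Theorem theorem1p2 (k : nat) (hk : 2 <= k) :
  exists f : Pplus k -> ssyt_sim k, monoid_morphism f /\ bijective f.
Proof.
exists (fun g => \pi_(ssyt_sim k) (tab_of g))%qT; split.
  by split=> [|g h]; rewrite ?tab_of1 ?tab_ofM ?pi_ssyt_mul.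
have f_inj : injective (fun g : Pplus k => \pi_(ssyt_sim k) (tab_of g))%qT.
  move=> g h /eqP/pi_ssyt_eq/red_eqP eq_gh; apply: expo_inj => i a.
  have [ia|ia_out] := boolP (i.+2 <= a <= k); last by rewrite !expo_out.
  have lt_i : i < k.-1 by lia.
  have ne_a : a != i.+1 by lia.
  have := eq_gh i a lt_i ne_a.
  by rewrite !count_tab_of // /filling (negPf ne_a).
have f_surj (c : ssyt_sim k) : exists g, (\pi_(ssyt_sim k) (tab_of g) == c)%qT.
  elim/quotW: c => T.
  have [g gE] := expo_surj k (fun i a => count_mem a (nth [::] (rows T) i)).
  exists g; apply/pi_ssyt_eq/red_eqP => i a lt_i ne_a.
  rewrite count_tab_of // /filling (negPf ne_a) add0n.
  have [/gE //|ia_out] := boolP (i.+2 <= a <= k).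
  (* An entry of row [i] that is not leading is at least [i + 2]. *)
  rewrite expo_out //; apply/esym/count_memPn/negP => a_in.
  have /andP[a_gt0 le_ak] := allP (row_bounds T i) a a_in.
  have := row_ge T i; apply/eqP; rewrite -lt0n -has_count.
  by apply/hasP; exists a => //=; lia.
exists (fun c => xchoose (f_surj c)) => [g|c]; last exact/eqP/(xchooseP (f_surj c)).
by apply: f_inj; apply/eqP/(xchooseP (f_surj _)).
Qed.
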